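(* Let $\mathbf{X}_1,\mathbf{X}_2,\mathbf{X}_3$ be (possibly different) BNM schemes, and let $\mathbb{SS}$, $\mathbb{TT}$, $\mathbb{TS}$ be the sets of inferences valid according to the standard $\mathbf{ss}$ over $\mathbf{X}_1$, the standard $\mathbf{tt}$ over $\mathbf{X}_2$, and the standard $\mathbf{ts}$ over $\mathbf{X}_3$, respectively. Then $$T^d(\mathbb{TT}\cap\mathbb{SS})=\mathbb{TS},$$ where $T^d$ denotes dual transitive closure.
   Context: Formulas: the propositional language $\mathcal{L}$ is built from a denumerably infinite set $\mathit{Var}$ of propositional variables using only $\neg$, $\lor$, $\wedge$ (no propositional constants). An inference $\Gamma\Rightarrow\phi$ is an ordered pair $\langle\Gamma,\phi\rangle$ with $\Gamma\subseteq\mathcal{L}$ finite (possibly empty) and $\phi\in\mathcal{L}$. Schemes: a (three-valued) scheme $\mathbf{X}$ is a triple $(f_\neg,f_\wedge,f_\vee)$ of operations on $\{0,\frac12,1\}$ (unary, binary, binary). It is Boolean normal if each operation, restricted to arguments in $\{0,1\}$, agrees with the corresponding operation of the two-element Boolean algebra. Let $\leq_{\rm I}$ be the partial order on $\{0,\frac12,1\}$ whose strict part is $\frac12<_{\rm I}0$ and $\frac12<_{\rm I}1$. The scheme is monotonic if each of its operations is monotone from the componentwise order induced by $\leq_{\rm I}$ to $\leq_{\rm I}$. A BNM scheme is a Boolean normal monotonic scheme. An $\mathbf{X}$-valuation is a map $v:\mathcal{L}\to\{0,\frac12,1\}$ such that $v(\neg\phi)=f_\neg(v(\phi))$, $v(\phi\wedge\psi)=f_\wedge(v(\phi),v(\psi))$,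 $v(\phi\vee\psi)=f_\vee(v(\phi),v(\psi))$. Standards: let $\mathbf{s}=\{1\}$ and $\mathbf{t}=\{1,\frac12\}$. For $\mathbf{x},\mathbf{y}\in\{\mathbf{s},\mathbf{t}\}$, a valuation $v$ satisfies $\Gamma\Rightarrow\phi$ according to $\mathbf{xy}$ if: whenever $v(\gamma)\in\mathbf{x}$ for all $\gamma\in\Gamma$, then $v(\phi)\in\mathbf{y}$. An inference is valid according to $\mathbf{xy}$ over $\mathbf{X}$ if it is satisfied according to $\mathbf{xy}$ by every $\mathbf{X}$-valuation. Dual transitive closure: for a set of inferences $\mathbb{L}$, $T^d(\mathbb{L})$ is the greatest set $\mathbb{L}'\subseteq\mathbb{L}$ such that, for all inferences $\Gamma\Rightarrow\phi$: if there is a finite $\Delta\neq\emptyset$ with $\Delta\Rightarrow\phi\notin\mathbb{L}'$ and $\Gamma\Rightarrow\delta\notin\mathbb{L}'$ for all $\delta\in\Delta$, then $\Gamma\Rightarrow\phi\notin\mathbb{L}'$. *)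

(* Defs.v *)
From HB Require Import structures.
From mathcomp Require Import all_boot finmap.
From mathcomp Require Import boolp classical_sets.

Set Implicit Arguments.
Unset Strict Implicit.
Unset Printing Implicit Defensive.

Local Open Scope classical_set_scope.

Inductive form : Type :=
| Var of nat
| Neg of form
| And of form & form
| Or of form & form.

(* Countable structure on formulas, needed to form {fset form}. *)
Fixpoint form_encode (f : form) : GenTree.tree nat :=
  match f with
  | Var n => GenTree.Leaf n
  | Neg a => GenTree.Node 0 [:: form_encode a]
  | And a b => GenTree.Node 1 [:: form_encode a; form_encode b]
  | Or a b => GenTree.Node 2 [:: form_encode a; form_encode b]
  end.

Fixpoint form_decode (t : GenTree.tree nat) : option form :=
  match t with
  | GenTree.Leaf n => Some (Var n)
  | GenTree.Node 0 [:: a] => omap Neg (form_decode a)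
  | GenTree.Node 1 [:: a; b] =>
      if (form_decode a, form_decode b) is (Some x, Some y)
      then Some (And x y) else None
  | GenTree.Node 2 [:: a; b] =>
      if (form_decode a, form_decode b) is (Some x, Some y)
      then Some (Or x y) else None
  | _ => None
  end.

Lemma form_encodeK : pcancel form_encode form_decode.
Proof. by elim=> [n|a IHa|a IHa b IHb|a IHa b IHb] //=; rewrite IHa ?IHb. Qed.

HB.instance Definition _ := Countable.copy form (pcan_type form_encodeK).

(* The pair (G, phi) is the inference G => phi. *)
Definition inference : Type := {fset form} * form.

Inductive tv : Type := tv0 | tvhalf | tv1.

Definition tv_of_bool (b : bool) : tv := if b then tv1 else tv0.

Record scheme : Type := Scheme {
  sneg : tv -> tv;
  sand : tv -> tv -> tv;
  sor : tv -> tv -> tv }.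

Definition boolean_normal (X : scheme) : Prop :=
  [/\ forall a : bool, sneg X (tv_of_bool a) = tv_of_bool (~~ a),
      forall a b : bool,
        sand X (tv_of_bool a) (tv_of_bool b) = tv_of_bool (a && b) &
      forall a b : bool,
        sor X (tv_of_bool a) (tv_of_bool b) = tv_of_bool (a || b)].

(* Information order: 1/2 lies below 0 and 1, which are incomparable. *)
Definition leI (x y : tv) : Prop := x = tvhalf \/ x = y.

Definition monotonic (X : scheme) : Prop :=
  [/\ forall x x', leI x x' -> leI (sneg X x) (sneg X x'),
      forall x x' y y', leI x x' -> leI y y' ->
        leI (sand X x y) (sand X x' y') &
      forall x x' y y', leI x x' -> leI y y' ->
        leI (sor X x y) (sor X x' y')].

Definition BNM (X : scheme) : Prop := boolean_normal X /\ monotonic X.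

Definition valuation (X : scheme) (v : form -> tv) : Prop :=
  [/\ forall a, v (Neg a) = sneg X (v a),
      forall a b, v (And a b) = sand X (v a) (v b) &
      forall a b, v (Or a b) = sor X (v a) (v b)].

Definition std_s : set tv := [set tv1].
Definition std_t : set tv := [set tv1; tvhalf].

Definition satisfies (x y : set tv) (v : form -> tv) (i : inference) : Prop :=
  (forall g, g \in i.1 -> x (v g)) -> y (v i.2).

Definition valid (x y : set tv) (X : scheme) : set inference :=
  [set i | forall v, valuation X v -> satisfies x y v i].

Definition SS : scheme -> set inference := valid std_s std_s.
Definition TT : scheme -> set inference := valid std_t std_t.
Definition TS : scheme -> set inference := valid std_t std_s.

Definition dual_transitive (L : set inference) : Prop :=
  forall (G : {fset form}) (phi : form),
    (exists D : {fset form},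
       [/\ D <> fset0, ~ L (D, phi) & forall d, d \in D -> ~ L (G, d)]) ->
    ~ L (G, phi).

(* The union of all dual transitive subsets of L; Td_greatest shows that it is
   itself dual transitive, hence the greatest such subset. *)
Definition Td (L : set inference) : set inference :=
  \bigcup_(L' in [set L' | L' `<=` L /\ dual_transitive L']) L'.

Lemma Td_greatest (L : set inference) :
  [/\ Td L `<=` L, dual_transitive (Td L) &
      forall L', L' `<=` L -> dual_transitive L' -> L' `<=` Td L].
Proof.
split=> [i [L' [sL' _]] /sL' //| |L' sL' dL' i L'i]; last by exists L'.
move=> G phi [D [D0 nphi nd]] [L' [sL' dL'] L'phi].
apply: (dL' G phi _ L'phi); exists D; split=> // [L'D|d dD L'd].
  by apply: nphi; exists L'.
by apply: (nd d dD); exists L'.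
Qed.

(* Main.v *)
Require Import Defs.
From mathcomp Require Import all_boot finmap.
From mathcomp Require Import boolp classical_sets.

Local Open Scope classical_set_scope.

(** Both sides are empty.

    In a BNM scheme the value 1/2 is a fixed point of every operation
    ([neg_half], [and_half], [or_half]): by monotonicity the value at 1/2 lies
    below the values at 0 and at 1, and Boolean normality makes these two
    incomparable.  Hence a formula whose variables all have the value 1/2 has
    the value 1/2 itself ([eval_half]).  Giving 1/2 to every variable therefore
    refutes every inference by the standard ts, so TS is empty ([TS_empty]).

    For the other side, let p be a variable that does not occur in
    Gamma => phi.  A valuation with p = 1 and with 1/2 on the variables of phi
    refutes p => phi by the standard ss ([fresh_premise_not_SS]); one with
    p = 0 and with 1/2 on the variables of Gamma refutes Gamma => p by the
    standard tt ([fresh_conclusion_not_TT]).  So neither inference belongs to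
    both TT and SS, and closing under dual transitivity with Delta = {p} removes
    Gamma => phi, whatever it is. *)

(** 0 and 1 are incomparable, so their only common lower bound is 1/2.  The
    boolean argument lets Boolean normality rewrite the two upper bounds as
    values of an operation. *)
Lemma leI_half (x : tv) (b : bool) :
  leI x (tv_of_bool b) -> leI x (tv_of_bool (~~ b)) -> x = tvhalf.
Proof. by case: b => -[->|->] // [//|]. Qed.

Lemma neg_half (X : scheme) : BNM X -> sneg X tvhalf = tvhalf.
Proof.
move=> [[nE _ _] [mono _ _]].
(* With the boolean in the form [~~ true], both bounds are values of [sneg]. *)
by apply: (leI_half _ (~~ true)); rewrite -nE; apply: mono; left.
Qed.

Lemma and_half (X : scheme) : BNM X -> sand X tvhalf tvhalf = tvhalf.
Proof.
move=> [[_ aE _] [_ mono _]].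
by apply: (leI_half _ true); rewrite -[X in tv_of_bool X]andbb -aE;
  apply: mono; left.
Qed.

Lemma or_half (X : scheme) : BNM X -> sor X tvhalf tvhalf = tvhalf.
Proof.
move=> [[_ _ oE] [_ _ mono]].
by apply: (leI_half _ true); rewrite -[X in tv_of_bool X]orbb -oE;
  apply: mono; left.
Qed.

Fixpoint eval (X : scheme) (e : nat -> tv) (a : form) : tv :=
  match a with
  | Var n => e n
  | Neg a => sneg X (eval X e a)
  | And a b => sand X (eval X e a) (eval X e b)
  | Or a b => sor X (eval X e a) (eval X e b)
  end.

Lemma eval_valuation (X : scheme) (e : nat -> tv) : valuation X (eval X e).
Proof. by split. Qed.

(** A strict upper bound, so that the bound itself is the index of a fresh
    variable. *)
Fixpoint var_bound (a : form) : nat :=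
  match a with
  | Var n => n.+1
  | Neg a => var_bound a
  | And a b | Or a b => maxn (var_bound a) (var_bound b)
  end.

(** All indices from [n] on get the value [x]; only [n] itself matters, as a
    variable fresh for the formulas bounded by [n]. *)
Definition half_below (n : nat) (x : tv) (m : nat) : tv :=
  if m < n then tvhalf else x.

Lemma eval_half (X : scheme) (n : nat) (x : tv) (a : form) :
  BNM X -> var_bound a <= n -> eval X (half_below n x) a = tvhalf.
Proof.
move=> hX; elim: a => [m|a IHa|a IHa b IHb|a IHa b IHb] /=.
- by rewrite /half_below => ->.
- by move=> /IHa ->; apply: neg_half.
- by rewrite geq_max => /andP[/IHa -> /IHb ->]; apply: and_half.
- by rewrite geq_max => /andP[/IHa -> /IHb ->]; apply: or_half.
Qed.

Lemma eval_fresh (X : scheme) (n : nat) (x : tv) :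
  eval X (half_below n x) (Var n) = x.
Proof. by rewrite /= /half_below ltnn. Qed.

Lemma fresh_exists (i : inference) :
  exists n, var_bound i.2 <= n /\ forall g, g \in i.1 -> var_bound g <= n.
Proof.
exists (maxn (var_bound i.2) (\max_(g <- i.1) var_bound g)).
split=> [|g gi]; first exact: leq_maxl.
exact/(leq_trans _ (leq_maxr _ _))/leq_bigmax_seq.
Qed.

Lemma TS_empty (X : scheme) : BNM X -> TS X = set0.
Proof.
move=> hX; apply/seteqP; split=> // i ivalid.
have [n [phi_n G_n]] := fresh_exists i.
have := ivalid _ (eval_valuation X (half_below n tvhalf)).
rewrite /satisfies (eval_half X n _ i.2 hX phi_n) => phi1.
suff : std_s tvhalf by [].
by apply: phi1 => g /G_n g_n; rewrite eval_half //; right.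
Qed.

(** The value 1 at the fresh variable makes the premise true, while the
    conclusion stays undetermined. *)
Lemma fresh_premise_not_SS (X : scheme) (n : nat) (phi : form) :
  BNM X -> var_bound phi <= n -> ~ SS X ([fset Var n]%fset, phi).
Proof.
move=> hX phi_n /(_ _ (eval_valuation X (half_below n tv1))).
rewrite /satisfies eval_half // => phi1.
suff : std_s tvhalf by [].
by apply: phi1 => g /=; rewrite inE => /eqP ->; rewrite eval_fresh.
Qed.

(** Undetermined premises pass the tolerant standard, while the value 0 at the
    fresh variable makes the conclusion false. *)
Lemma fresh_conclusion_not_TT (X : scheme) (n : nat) (G : {fset form}) :
  BNM X -> (forall g, g \in G -> var_bound g <= n) -> ~ TT X (G, Var n).
Proof.
move=> hX G_n /(_ _ (eval_valuation X (half_below n tv0))).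
rewrite /satisfies eval_fresh => p0.
suff : std_t tv0 by case.
by apply: p0 => g /G_n g_n; rewrite eval_half //; right.
Qed.

Theorem theorem4p6 (X1 X2 X3 : scheme)
    (hX1 : BNM X1) (hX2 : BNM X2) (hX3 : BNM X3) :
  Td (TT X2 `&` SS X1) = TS X3.
Proof.
rewrite TS_empty //; apply/seteqP; split=> // -[G phi] TdG.
have [TdL Tdual _] := Td_greatest (TT X2 `&` SS X1).
have [n [phi_n G_n]] := fresh_exists (G, phi).
apply: Tdual TdG; exists [fset Var n]%fset; split.
- by move=> /fsetP /(_ (Var n)); rewrite !inE eqxx.
- by move=> /TdL [_]; apply: fresh_premise_not_SS.
- move=> d; rewrite inE => /eqP -> /TdL [+ _].
  exact: fresh_conclusion_not_TT.
Qed.
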